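(* Let $c\ge 2$ be an integer. For $x,y\in\mathbb{N}_0^c$ define $$x\preccurlyeq y \iff \beta_n(x)\le\beta_n(y)\quad\text{for all } n\in\mathbb{N}_0 .$$ Then: (1) $\preccurlyeq$ is a preorder on $\mathbb{N}_0^c$. (2) The indifference relation $\sim$, defined by $x\sim y$ if and only if $x\preccurlyeq y$ and $y\preccurlyeq x$, satisfies $$x\sim y \iff \exists\,\sigma\in\mathfrak{S}_c:\ (x^{\sigma(1)},\dots,x^{\sigma(c)})=(y^1,\dots,y^c),$$ and thus $\preccurlyeq$ defines a partial order up to permutation of the coordinates (that is, on the quotient of $\mathbb{N}_0^c$ by coordinate permutations). (3) For all $x,y\in\mathbb{N}_0^c$, $$x\preccurlyeq y\iff \sum_{i=1}^c f(x^i)\le\sum_{i=1}^c f(y^i)\ \text{ for every non-decreasing convex function } f:\mathbb{R}_+\to\mathbb{R}.$$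
   Context: $\mathbb{N}_0=\{0,1,2,\dots\}$, $\mathbb{R}_+=[0,\infty)$, and $\mathfrak{S}_c$ is the group of permutations of $\{1,\dots,c\}$. For $x=(x^i)_{1\le i\le c}\in\mathbb{N}_0^c$ and $n\in\mathbb{N}_0$, $\beta_n(x)=\sum_{i=1}^c (x^i-n)^+$, where $a^+=\max(a,0)$. *)

(* Defs.v *)
From mathcomp Require Import all_boot all_order all_algebra all_fingroup.
From mathcomp Require Import all_classical all_reals all_analysis.

Set Implicit Arguments.
Unset Strict Implicit.
Unset Printing Implicit Defensive.

Import Order.TTheory GRing.Theory Num.Theory.

Local Open Scope nat_scope.

Definition config (c : nat) := {ffun 'I_c -> nat}.

(* Natural number subtraction is truncated at 0, so that [x i - n] is the
   positive part $(x^i - n)^+$. *)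
Definition beta (c : nat) (n : nat) (x : config c) : nat :=
  \sum_(i < c) (x i - n).

Definition prec (c : nat) (x y : config c) : Prop :=
  forall n : nat, beta n x <= beta n y.

Definition indiff (c : nat) (x y : config c) : Prop :=
  prec x y /\ prec y x.

Definition perm_equiv (c : nat) (x y : config c) : bool :=
  [exists s : 'S_c, [ffun i => x (s i)] == y].

Lemma perm_equiv_refl (c : nat) : reflexive (@perm_equiv c).
Proof.
by move=> x; apply/existsP; exists 1%g; apply/eqP/ffunP => i; rewrite ffunE perm1.
Qed.

Lemma perm_equiv_sym (c : nat) : symmetric (@perm_equiv c).
Proof.
have H (x y : config c) : perm_equiv x y -> perm_equiv y x.
  case/existsP => s /eqP <-; apply/existsP; exists (s^-1)%g.
  by apply/eqP/ffunP => i; rewrite !ffunE permKV.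
by move=> x y; apply/idP/idP; apply: H.
Qed.

Lemma perm_equiv_trans (c : nat) : transitive (@perm_equiv c).
Proof.
move=> y x z /existsP[s /eqP <-] /existsP[t /eqP <-].
by apply/existsP; exists (t * s)%g; apply/eqP/ffunP => i; rewrite !ffunE permM.
Qed.

Definition perm_equiv_rel (c : nat) : equiv_rel (config c) :=
  EquivRel (@perm_equiv c) (@perm_equiv_refl c) (@perm_equiv_sym c)
    (@perm_equiv_trans c).

Definition config_quot (c : nat) := {eq_quot (perm_equiv_rel c)}%qT.

Definition config_class (c : nat) (x : config c) : config_quot c :=
  (\pi_({eq_quot (perm_equiv_rel c)}) x)%qT.

(* Defined through some choice of representatives; independence of that choice
   is not built in. *)
Definition prec_quot (c : nat) (p q : config_quot c) : Prop :=
  exists x y : config c,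
    [/\ config_class x = p, config_class y = q & prec x y].

(* A function on $[0, +\infty)$ is represented by any extension of it to R:
   only its values on $[0, +\infty)$ are constrained. *)
Definition nondecreasing_convex (R : realType) (f : R -> R) : Prop :=
  {in `[0%R, +oo[%R &, {homo f : a b / (a <= b)%R}} /\
  @convex_function R R^o (`[0%R : R, +oo[%classic : set R) f.

(* Main.v *)
(* Write $a^+ = \max(a, 0)$. Everything rests on the expansion
   $f(k) = f(0) + \sum_{n} (k - n)^+ a_n$ of a function on $\mathbb{N}_0$,
   where $a_0 = f(1) - f(0)$ and $a_n = f(n+1) - 2 f(n) + f(n-1)$ for
   $n \ge 1$: when $f$ is non-decreasing and convex the weights $a_n$ are
   non-negative, so that $\sum_i f(x^i) = c f(0) + \sum_n a_n \beta_n(x)$ is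
   monotone in the $\beta_n(x)$; conversely $\beta_n$ is itself the sum
   associated with the convex function $r \mapsto (r - n)^+$. Moreover
   $\beta_n(x) - \beta_{n+1}(x)$ counts the coordinates of $x$ exceeding $n$,
   so the numbers $\beta_n(x)$ determine $x$ up to a permutation. *)
Require Import Defs.
From Corelib Require Relation_Definitions.
From mathcomp Require Import all_boot all_order all_algebra all_fingroup.
From mathcomp Require Import all_classical all_reals all_analysis.
From mathcomp Require Import lra.

Import Order.TTheory GRing.Theory Num.Theory.

Lemma prec_preorder (c : nat) : Relation_Definitions.preorder _ (@prec c).
Proof.
by split=> [x n //|y x z xy yz n]; exact: leq_trans (xy n) (yz n).
Qed.

Lemma beta_perm (c n : nat) (s : 'S_c) (x : config c) :
  beta n [ffun i => x (s i)] = beta n x.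
Proof.
rewrite /beta [RHS](reindex_inj (@perm_inj _ s)).
by apply: eq_bigr => i _; rewrite ffunE.
Qed.

Lemma beta_recr (c n : nat) (x : config c) :
  beta n x = (beta n.+1 x + #|[pred i | (n < x i)%N]|)%N.
Proof.
rewrite -sum1_card big_mkcond -big_split; apply: eq_bigr => i _.
rewrite inE /= subnS; case: ltnP => [lt_n|le_n].
  by rewrite addn1 prednK // subn_gt0.
(* Here [x i - n] is 0 and its truncated predecessor is 0 as well. *)
by rewrite (eqP le_n).
Qed.

(** Being equal to [k] or above it means exceeding [k - 1], which for [k = 0] is no condition at
    all. This turns the counts of coordinates above each level into the multiplicity of each
    value. *)
Lemma card_eq_gt (c k : nat) (x : config c) :
  (#|[pred i | x i == k]| + #|[pred i | (k < x i)%N]|)%N =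
  if k is n.+1 then #|[pred i | (n < x i)%N]| else c.
Proof.
have disj : #|[predI [pred i | x i == k] & [pred i | (k < x i)%N]]| = 0%N.
  by apply: eq_card0 => i; rewrite !inE; case: eqP => // ->; rewrite ltnn.
rewrite -cardUI disj addn0; case: k {disj} => [|n].
  by rewrite -[RHS]card_ord; apply: eq_card => i; rewrite !inE; case: (x i).
by apply: eq_card => i; rewrite !inE [RHS]leq_eqVlt eq_sym.
Qed.

Lemma indiff_perm (c : nat) (x y : config c) :
  indiff x y <-> exists s : 'S_c, [ffun i => x (s i)] = y.
Proof.
split=> [[xy yx]|[s <-]]; last by split=> n; rewrite beta_perm.
have eq_beta n : beta n x = beta n y by apply/eqP; rewrite eqn_leq xy yx.
have eq_gt n : #|[pred i | (n < x i)%N]| = #|[pred i | (n < y i)%N]|.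
  have := beta_recr c n x; rewrite eq_beta beta_recr eq_beta.
  by move/addnI.
have eq_at k : #|[pred i | x i == k]| = #|[pred i | y i == k]|.
  apply: (@addIn #|[pred i | (k < x i)%N]|); rewrite card_eq_gt eq_gt card_eq_gt.
  by case: k => [|n] //; rewrite eq_gt.
have count_tuple (z : config c) k :
    count_mem k [tuple z i | i < c] = #|[pred i | z i == k]|.
  rewrite /= count_map -size_filter cardE enumT.
  by congr size; apply: eq_filter => i; rewrite inE.
(* Equal multiplicities make the two tuples rearrangements of each other; [y] comes first so that
   [s] acts on the coordinates of [x]. *)
have /tuple_permP[s eq_s] :
    perm_eq [tuple y i | i < c] [tuple x i | i < c].
  by apply/allP => k _ /=; rewrite !count_tuple eq_at.
exists s; apply/ffunP => i; rewrite ffunE.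
have := congr1 (fun t => tnth t i) (val_inj eq_s).
by rewrite !tnth_mktuple.
Qed.

Local Open Scope ring_scope.

Lemma config_classP (c : nat) (x y : config c) :
  config_class x = config_class y <-> indiff x y.
Proof.
rewrite indiff_perm; split.
  by move/eqquotP => /existsP[s /eqP]; exists s.
by case=> s xy; apply/eqquotP/existsP; exists s; apply/eqP.
Qed.

(** The representatives hidden in [prec_quot] are indifferent to [x] and [y], so transitivity shows
    that their choice is immaterial. *)
Lemma prec_quot_class (c : nat) (x y : config c) :
  prec_quot (config_class x) (config_class y) <-> prec x y.
Proof.
split=> [[x' [y' [/config_classP[_ xx'] /config_classP[y'y _] x'y']]] n|xy].
  exact: leq_trans (xx' n) (leq_trans (x'y' n) (y'y n)).
by exists x, y.
Qed.

Lemma prec_quot_order (c : nat) : Relation_Definitions.order _ (@prec_quot c).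
Proof.
have [refl trans] := prec_preorder c.
have classK (p : config_quot c) : {x | config_class x = p}.
  by exists (generic_quotient.repr p); rewrite /config_class reprK.
split=> [p|p q r|p q].
- by case: (classK p) => x <-; apply/prec_quot_class/refl.
- case: (classK p) (classK q) (classK r) => x <- [y <-] [z <-].
  rewrite !prec_quot_class; exact: trans.
- case: (classK p) (classK q) => x <- [y <-].
  by rewrite !prec_quot_class => xy yx; apply/config_classP.
Qed.

Definition second_diff (V : zmodType) (f : nat -> V) (n : nat) : V :=
  if n is m.+1 then (f m.+2 - f m.+1) - (f m.+1 - f m) else f 1%N - f 0%N.

(** Terms with [n >= k] vanish by truncation, so one bound [m] can serve many values of [k]. The
    proof is by induction on [k]. *)
Lemma second_diff_expansion (V : zmodType) (f : nat -> V) (m k : nat) :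
  (k <= m)%N -> f k = f 0%N + \sum_(n < m) second_diff V f n *+ (k - n).
Proof.
have sum_second_diff j : \sum_(n < j.+1) second_diff V f n = f j.+1 - f j.
  elim: j => [|j IHj]; first by rewrite big_ord1.
  by rewrite big_ord_recr IHj /= addrC subrK.
elim: k => [_|k IHk lt_k_m].
  by rewrite big1 ?addr0 // => n _; rewrite sub0n mulr0n.
(* Passing from [k] to [k.+1] raises the multiplicity by one exactly when [n <= k]; the added
   weights telescope to [f k.+1 - f k]. *)
have -> : \sum_(n < m) second_diff V f n *+ (k.+1 - n) =
    \sum_(n < m) second_diff V f n *+ (k - n) +
    \sum_(n < m | (n < k.+1)%N) second_diff V f n.
  rewrite [X in _ = _ + X]big_mkcond -big_split; apply: eq_bigr => n _ /=.
  case: ltnP => [le_n|lt_n]; first by rewrite subSn // mulrSr.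
  by rewrite (eqP lt_n) (eqP (ltnW lt_n)) !mulr0n addr0.
rewrite addrA -IHk ?(ltnW lt_k_m) //.
rewrite -(big_ord_widen m (second_diff V f) lt_k_m) sum_second_diff.
by rewrite addrC subrK.
Qed.

Section Convex.
Variable R : realType.

Lemma mem_nonneg (r : R) : (r \in (`[0, +oo[%classic : set R)) = (0 <= r).
Proof. by rewrite mem_setE in_itv /= andbT. Qed.

(** Monotonicity settles index 0; beyond it, this is midpoint convexity between two integers at
    distance 2. *)
Lemma second_diff_ge0 (f : R -> R) (n : nat) :
  nondecreasing_convex f -> 0 <= second_diff R (fun k => f k%:R) n.
Proof.
case=> f_nd f_cvx; case: n => [|n] /=.
  by rewrite subr_ge0; apply: f_nd => //; rewrite in_itv /= ?lexx ?ler01.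
have half_ge0 : 0 <= 2^-1 :> R by lra.
have half_le1 : 2^-1 <= 1 :> R by lra.
have mid : 2^-1 * n.+2%:R + (1 - 2^-1) * n%:R = n.+1%:R :> R.
  rewrite -[n.+2]addn2 -[n.+1]addn1 !natrD; lra.
have : f n.+1%:R <= 2^-1 * f n.+2%:R + (1 - 2^-1) * f n%:R.
  rewrite -{1}mid.
  by apply: (f_cvx (Itv01 half_ge0 half_le1) n.+2%:R n%:R); rewrite mem_nonneg.
lra.
Qed.

Lemma pospart_nondecreasing_convex (a : R) :
  nondecreasing_convex (fun r => Num.max (r - a) 0).
Proof.
split=> [r s _ _ rs|t r s _ _].
  rewrite ge_max !le_max; lra.
have posE (z : R) : 0 <= Num.max (z - a) 0 /\ z - a <= Num.max (z - a) 0.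
  by rewrite !le_max !lexx orbT.
have [p_ge0 p_ge] := posE r; have [q_ge0 q_ge] := posE s.
have u_ge0 : 0 <= t%:num by exact: ge0.
have u_le1 : t%:num <= 1 by exact: le1.
have v_ge0 : 0 <= 1 - t%:num by rewrite subr_ge0.
have conv_a : t%:num * (r - a) + (1 - t%:num) * (s - a) =
    t%:num * r + (1 - t%:num) * s - a :> R by lra.
(* The convex combination of the two positive parts dominates both arguments of the outer
   maximum. *)
rewrite !convRE ge_max; apply/andP; split; last by rewrite addr_ge0 ?mulr_ge0.
by rewrite -[X in X <= _]conv_a lerD ?ler_wpM2l.
Qed.

Lemma prec_sum_convex (c : nat) (x y : config c) :
  prec x y <->
  forall f : R -> R, nondecreasing_convex f ->
    \sum_(i < c) f (x i)%:R <= \sum_(i < c) f (y i)%:R.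
Proof.
split=> [xy f f_cvx|le_sum n]; last first.
  have sum_pospart (z : config c) :
      \sum_(i < c) Num.max ((z i)%:R - n%:R) 0 = (beta n z)%:R :> R.
    rewrite natr_sum; apply: eq_bigr => i _; case: (leqP n (z i)) => h.
      by rewrite natrB //; apply/max_idPl; rewrite subr_ge0 ler_nat.
    rewrite (eqP (ltnW h)); apply/max_idPr.
    by rewrite subr_le0 ler_nat ltnW.
  rewrite -(ler_nat R) -!sum_pospart.
  exact: le_sum (pospart_nondecreasing_convex n%:R).
(* A crude common bound on all coordinates of [x] and [y], so that both expansions run over the same
   finite range. *)
pose m := (\sum_i x i + \sum_i y i)%N.
have sum_f (z : config c) : (forall i, z i <= m)%N ->
    \sum_(i < c) f (z i)%:R =
    \sum_(i < c) f 0 + \sum_(n < m) second_diff R (fun k => f k%:R) n *+ beta n z.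
  move=> le_m; under [X in _ = _ + X]eq_bigr do rewrite /beta -sumrMnr.
  rewrite [X in _ = _ + X]exchange_big -big_split.
  by apply: eq_bigr => i _; exact: second_diff_expansion.
have le_sum (z : config c) i : (z i <= \sum_j z j)%N.
  by rewrite (bigD1 i) //= leq_addr.
rewrite !sum_f => [|i|i]; first last.
- exact: leq_trans (le_sum x i) (leq_addr _ _).
- exact: leq_trans (le_sum y i) (leq_addl _ _).
rewrite lerD2l; apply: ler_sum => n _.
by rewrite ler_wpMn2l ?second_diff_ge0.
Qed.

End Convex.

Theorem theorem1 (R : realType) (c : nat) (hc : (2 <= c)%N) :
  Relation_Definitions.preorder (config c) (@prec c) /\
  ((forall x y : config c,
      indiff x y <-> exists s : 'S_c, [ffun i => x (s i)] = y) /\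
   (forall x y : config c,
      prec_quot (config_class x) (config_class y) <-> prec x y) /\
   Relation_Definitions.order (config_quot c) (@prec_quot c)) /\
  (forall x y : config c,
     prec x y <->
     forall f : R -> R, nondecreasing_convex f ->
       (\sum_(i < c) f (x i)%:R <= \sum_(i < c) f (y i)%:R)%R).
Proof.
split; first exact: prec_preorder.
split; last exact: prec_sum_convex.
split; first exact: indiff_perm.
by split; [exact: prec_quot_class | exact: prec_quot_order].
Qed.
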